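(* Let $n\in\{1,2\}$, $\varepsilon>0$, $\lambda>0$, and let $u^0,u^1\in C^\infty(X^n)$ satisfy $D_x^2u^0+I_n\ge\lambda I_n$ and $D_x^2u^1+I_n\ge\lambda I_n$ on $X^n$. Let $u\in C^\infty(X^n\times[0,1])$ be the solution of the Monge-Ampère equation $$\det\big(D_{x,t}^2u+I_{n+1}\big)=\varepsilon\quad\text{on }X^n\times T,$$ with $D_{x,t}^2u+I_{n+1}\ge 0$ and Dirichlet data $u(x,0)=u^0(x)$, $u(x,1)=u^1(x)$. Then for all $(x,t)\in X^n\times T$, $$D_x^2u(x,t)+I_n\ge\lambda I_n,$$ with the same $\lambda$ (in particular the lower bound does not depend on $\varepsilon$).
   Context: $X^n=(\mathbf R/\mathbf Z)^n$ is the $n$-dimensional flat torus with coordinates $x=(x_1,\dots,x_n)$, and $T=(0,1)$ with coordinate $t$. $D_x^2u$ is the $n\times n$ Hessian of $u$ in the $x$ variables, $D_{x,t}^2u$ is the $(n+1)\times(n+1)$ Hessian in $(x,t)$. $I_n$ is the $n\times n$ identity matrix. Non-standard notation: $I_{n+1}$ denotes the $(n+1)\times(n+1)$ matrix whose upper left $n\times n$ block is $I_n$ and whose last row and last column (the $t$ row and column) are zero. Matrix inequalities are in the sense of symmetric matrices. For $\varepsilon>0$ it is known that the Dirichlet problem has a unique smooth solution with $D_{x,t}^2u+I_{n+1}\ge0$. *)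

(* Defs.v *)
From HB Require Import structures.
From mathcomp Require Import all_boot all_order all_algebra.
From mathcomp Require Import all_classical all_reals all_analysis.

Set Implicit Arguments.
Unset Strict Implicit.
Unset Printing Implicit Defensive.

Import Order.TTheory GRing.Theory Num.Theory.
Import numFieldNormedType.Exports.

Local Open Scope classical_set_scope.
Local Open Scope ring_scope.

Section Smoothness.
Variables (R : realType) (m : nat).
Implicit Types (f : 'rV[R]_m -> R) (U A : set 'rV[R]_m).

Definition partial f (i : 'I_m) : 'rV[R]_m -> R :=
  fun x => 'D_(delta_mx 0 i) f x.

(* [partials f [:: i1; ...; ik]] is d_ik ... d_i1 f. *)
Definition partials f (s : seq 'I_m) : 'rV[R]_m -> R := foldl partial f s.

Definition hessian f (x : 'rV[R]_m) : 'M[R]_m :=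
  \matrix_(i, j) partials f [:: i; j] x.

Definition smooth_open U f : Prop :=
  forall (s : seq 'I_m) (x : 'rV[R]_m), U x ->
    {for x, continuous (partials f s)} /\
    forall i, derivable (partials f s) x (delta_mx 0 i).

(* Smoothness on an arbitrary subset [A] of R^m: locally, [f] is the
   restriction to [A] of a smooth function on an open set. On R^m x [0,1]
   this is smoothness up to the boundary, and the values of [f] off [A] are
   irrelevant. *)
Definition smooth_on A f : Prop :=
  forall p, A p -> exists U : set 'rV[R]_m, exists F : 'rV[R]_m -> R,
    [/\ open U, U p, smooth_open U F & forall x, (A `&` U) x -> F x = f x].

(* Functions on the torus (R/Z)^m are Z^m-periodic functions on R^m. *)
Definition torus_periodic f : Prop :=
  forall z : 'rV[int]_m, periodic f (map_mx intr z).

End Smoothness.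

Section Loewner.
Variables (R : realType) (m : nat).

(* The order on symmetric matrices: symmetry is part of the relation. *)
Definition psdmx (A : 'M[R]_m) : Prop :=
  A^T = A /\ forall v : 'rV[R]_m, 0 <= (v *m A *m v^T) 0 0.

Definition mxge (A B : 'M[R]_m) : Prop := psdmx (A - B).

End Loewner.

Section SpaceTime.
Variables (R : realType) (n : nat).

Definition spacetime (x : 'rV[R]_n) (t : R) : 'rV[R]_(n + 1) :=
  row_mx x t%:M.

Definition slice (u : 'rV[R]_(n + 1) -> R) (t : R) : 'rV[R]_n -> R :=
  fun x => u (spacetime x t).

(* R^n x [0,1], the universal cover of X^n x [0,1]. *)
Definition closed_slab : set 'rV[R]_(n + 1) :=
  [set p | exists x t, 0 <= t <= 1 /\ p = spacetime x t].

(* The degenerate matrix written I_{n+1}: I_n with a zero t row and column. *)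
Definition space_id : 'M[R]_(n + 1) := block_mx 1%:M 0 0 0.

End SpaceTime.

(* Main.v *)
Require Import Defs.
From HB Require Import structures.
From mathcomp Require Import all_boot all_order all_algebra.
From mathcomp Require Import all_classical all_reals all_analysis.
From mathcomp Require Import ring lra.

Set Implicit Arguments.
Unset Strict Implicit.
Unset Printing Implicit Defensive.

Import Order.TTheory GRing.Theory Num.Theory.
Import numFieldNormedType.Exports.

Local Open Scope classical_set_scope.
Local Open Scope ring_scope.

(** Write A = D_x^2 u + I and fix a direction g. For n = 2 let f be g rotated by
    a right angle; then h = A(f,f) / (A(g,g) A(f,f) - A(g,f)^2) is, up to a
    constant factor, the quadratic form of A^-1 at g. Under the Legendre
    transform in x the equation becomes v_tt + eps det D_y^2 v = 0 and h
    becomes the second derivative of v along g, which in two variables satisfies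
    a linear elliptic equation without zeroth order term; so h attains its
    maximum on t = 0 or t = 1. The argument is carried out in the original
    variables: at an interior maximum of h + delta t^2 take a frame orthogonal
    for D^2 u + I_{n+1}, and compare the second order conditions along the frame
    with the second derivative of the equation along the first frame vector.
    A lower bound for A is finally read off the upper bound for h. *)

(** * Directional derivatives *)

Section DirectionalDerivative.
Variables (R : realType) (V : normedModType R).
Implicit Types (f : V -> R) (x v w : V).

Lemma near0_segment2 x v w (A : set V) : nbhs x A ->
  exists2 e : R, 0 < e &
    forall s t : R, `|s| <= e -> `|t| <= e -> A (x + s *: v + t *: w).
Proof.
move=> /nbhs_ballP[r /= r0 rA].
have M0 : 0 < `|v| + `|w| + 1 by rewrite ltr_wpDl// addr_ge0.
exists (r / 2 / (`|v| + `|w| + 1)); first by rewrite !divr_gt0.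
move=> s t se te; apply: rA; rewrite -ball_normE /= -addrA opprD addrA subrr add0r normrN.
apply: (@le_lt_trans _ _ (r / 2)); last by rewrite ltr_pdivrMr// ltr_pMr// ltrDl.
rewrite (le_trans (ler_normD _ _))// !normrZ.
set e := r / 2 / _ in se te *.
have -> : r / 2 = e * (`|v| + `|w| + 1) by rewrite /e divfK// gt_eqF.
rewrite mulrDr mulrDr mulr1 ler_wpDr//; first by rewrite ltW// !divr_gt0.
by rewrite lerD// ler_wpM2r.
Qed.

Lemma near0_segment x v (A : set V) : nbhs x A ->
  exists2 e : R, 0 < e & forall s : R, `|s| <= e -> A (x + s *: v).
Proof.
move=> /(near0_segment2 v 0)[e e0 eA]; exists e => // s se.
by have := eA s 0 se; rewrite normr0 (ltW e0) scaler0 addr0; apply.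
Qed.

Lemma is_derive_line f x v (s : R) : derivable f (x + s *: v) v ->
  is_derive s 1 (fun r : R => f (x + r *: v)) ('D_v f (x + s *: v)).
Proof.
have E : (fun h : R => h^-1 *: ((f \o shift (x + s *: v)) (h *: v)
    - f (x + s *: v))) =
  (fun h : R => h^-1 *: (((fun r : R => f (x + r *: v)) \o shift s) (h *: 1)
    - f (x + s *: v))).
  apply/funext => h /=; congr (_ *: (f _ - _)).
  by rewrite [h%:A]mulr1 scalerDl addrCA.
by rewrite /derivable E => df; apply: DeriveDef => //; rewrite /derive E.
Qed.

Lemma MVT_line f x v (h : R) :
  (forall s : R, `|s| <= `|h| -> derivable f (x + s *: v) v) ->
  exists2 s : R, `|s| <= `|h| &
    f (x + h *: v) - f x = 'D_v f (x + s *: v) * h.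
Proof.
move=> df; pose g (r : R) := f (x + r *: v).
have gE a b : a <= b -> (forall s, a <= s <= b -> `|s| <= `|h|) ->
    exists2 s : R, `|s| <= `|h| & g b - g a = 'D_v f (x + s *: v) * (b - a).
  move=> ab abh.
  have dg s : s \in `[a, b] -> is_derive s 1 g ('D_v f (x + s *: v)).
    by rewrite in_itv /= => /abh/df; exact: is_derive_line.
  have dgo s : s \in `]a, b[%R -> is_derive s 1 g ('D_v f (x + s *: v)).
    by move=> /subset_itv_oo_cc; exact: dg.
  have cg : {within `[a, b], continuous g}.
    by apply: derivable_within_continuous => s sab; case: (dg s sab).
  have [s sab E] := MVT_segment ab dgo cg.
  by exists s => //; apply: abh; move: sab; rewrite in_itv.
have g0 : g 0 = f x by rewrite /g scale0r addr0.
have [h0|/ltW h0] := leP 0 h.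
  have [s /andP[s0 sh]|s sh] := gE 0 h h0; first by rewrite !ger0_norm.
  by rewrite g0 subr0 => E; exists s.
have [s /andP[s0 sh]|s sh] := gE h 0 h0; first by rewrite !ler0_norm// lerN2.
by rewrite g0 sub0r mulrN -opprB => /oppr_inj E; exists s.
Qed.

(** The increment along [v + w] is split into a step along [w] from [x] and a step along [v] from
    the moved point. The mean value theorem turns the second step into a value of ['D_v f] near [x],
    and continuity at [x] gives its limit. *)
Lemma is_deriveDdir f x v w :
  (\forall y \near x, derivable f y v) -> {for x, continuous ('D_v f)} ->
  derivable f x w -> is_derive x (v + w) f ('D_v f x + 'D_w f x).
Proof.
move=> dfv cfv dfw.
suff H : h^-1 *: ((f \o shift x) (h *: (v + w)) - f x) @[h --> 0^'] -->
    'D_v f x + 'D_w f x.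
  apply: DeriveDef; first by apply/cvg_ex; exists ('D_v f x + 'D_w f x).
  exact: cvg_lim H.
have -> : (fun h : R => h^-1 *: ((f \o shift x) (h *: (v + w)) - f x)) =
   (fun h : R => h^-1 *: (f (h *: w + x + h *: v) - f (h *: w + x))) +
   (fun h : R => h^-1 *: ((f \o shift x) (h *: w) - f x)).
  apply/funext => h /=; rewrite -[RHS]/(_ *: _ + _ *: _) -scalerDr.
  congr (_ *: _); rewrite addrA subrK; congr (f _ - _).
  by rewrite scalerDr -addrA addrC.
apply: cvgD; last exact: dfw.
apply/cvgrPdist_le => e e0.
have : \forall y \near x, derivable f y v /\ `|'D_v f x - 'D_v f y| <= e.
  by apply: filterI => //; have /cvgrPdist_le := cfv; apply.
move=> /(near0_segment2 w v)[r r0 H].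
apply/nbhs_ballP; exists r => //= h; rewrite -ball_normE /= sub0r normrN => hr h0.
have [|s sh ->] := @MVT_line f (h *: w + x) v h.
  move=> s sh; rewrite (addrC _ x); apply: (H _ _ _ _).1; first exact: ltW.
  exact: le_trans sh (ltW hr).
rewrite [_ *: (_ * h)]mulrCA mulVf// mulr1 (addrC _ x).
by apply: (H _ _ _ _).2; [exact: ltW|exact: le_trans sh (ltW hr)].
Qed.

Lemma is_deriveZdir f x v (k : R) :
  derivable f x v -> is_derive x (k *: v) f (k * 'D_v f x).
Proof.
move=> df; have [->|k0] := eqVneq k 0.
  by rewrite scale0r mul0r; exact: is_derive0.
suff H : h^-1 *: ((f \o shift x) (h *: (k *: v)) - f x) @[h --> 0^'] -->
    k * 'D_v f x.
  apply: DeriveDef; first by apply/cvg_ex; exists (k * 'D_v f x).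
  exact: cvg_lim H.
have -> : (fun h : R => h^-1 *: ((f \o shift x) (h *: (k *: v)) - f x)) =
  (fun h : R => k *: ((h * k)^-1 *: ((f \o shift x) ((h * k) *: v) - f x))).
  apply/funext => h /=; rewrite !scalerA.
  have [->|h0] := eqVneq h 0; first by rewrite !(mul0r, invr0, mulr0, scale0r).
  by congr (_ *: _); rewrite invfM mulrCA divff ?mulr1.
apply: cvgZl_tmp.
have : h * k @[h --> (0 : R)^'] --> (0 : R)^'.
  move=> A /nbhs_ballP[r /= r0 rA].
  apply/nbhs_ballP; exists (r / `|k|); first by rewrite /= divr_gt0 ?normr_gt0.
  move=> h; rewrite -ball_normE /= sub0r normrN => hr h0; apply: rA.
    by rewrite -ball_normE /= sub0r normrN normrM -ltr_pdivlMr ?normr_gt0.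
  by rewrite mulf_neq0.
by move=> hk; exact: (cvg_comp _ _ hk df).
Qed.

End DirectionalDerivative.

(** * Symmetry of iterated directional derivatives *)

Section Schwarz.
Variables (R : realType) (V : normedModType R).
Implicit Types (f : V -> R) (x v w c : V).

Lemma is_derive_translate f x v c : derivable f (x + c) v ->
  is_derive x v (fun y => f (y + c)) ('D_v f (x + c)).
Proof.
have E : (fun h : R => h^-1 *: ((f \o shift (x + c)) (h *: v) - f (x + c))) =
  (fun h : R => h^-1 *: (((fun y => f (y + c)) \o shift x) (h *: v) - f (x + c))).
  by apply/funext => h /=; rewrite addrA.
by rewrite /derivable E => df; apply: DeriveDef => //; rewrite /derive E.
Qed.

(** The mean value theorem is applied twice: along [v] to the increment [f (y + h *: w) - f y], then
    along [w] to ['D_v f]. *)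
Lemma second_difference f x v w (h : R) :
  (forall s t : R, `|s| <= `|h| -> `|t| <= `|h| ->
     derivable f (x + s *: v + t *: w) v /\
     derivable ('D_v f) (x + s *: v + t *: w) w) ->
  exists s, exists t : R, [/\ `|s| <= `|h|, `|t| <= `|h| &
    f (x + h *: v + h *: w) - f (x + h *: v) - (f (x + h *: w) - f x) =
    'D_w ('D_v f) (x + s *: v + t *: w) * h * h].
Proof.
move=> H; pose g y := f (y + h *: w) - f y.
have dg (s : R) : `|s| <= `|h| -> is_derive (x + s *: v) v g
    ('D_v f (x + s *: v + h *: w) - 'D_v f (x + s *: v)).
  move=> sh; apply: is_deriveB.
    by apply: is_derive_translate; exact: (H _ _ _ _).1.
  apply/derivableP; have := (H s 0 sh _).1; rewrite normr0 scale0r addr0.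
  exact.
have [s sh Es] := @MVT_line _ _ g x v h (fun s sh => @ex_derive _ _ _ _ _ _ _ (dg s sh)).
have [t th Et] := @MVT_line _ _ ('D_v f) (x + s *: v) w h
  (fun t th => (H s t sh th).2).
exists s, t; split => //; move: Es; rewrite (@derive_val _ _ _ _ _ _ _ (dg s sh)).
by rewrite Et => <-; rewrite /g.
Qed.

Lemma distr_half2 (a b p q e : R) :
  `|a - p| <= e / 2 -> `|b - q| <= e / 2 -> p = q -> `|a - b| <= e.
Proof.
move=> ap bq pq; rewrite -pq in bq; rewrite (splitr e) -(subrKA p).
by rewrite (le_trans (ler_normD _ _))// lerD// distrC.
Qed.

(** The second difference is symmetric in [v] and [w], so the two mixed derivatives take a common
    value at two points close to [x]. Continuity of both at [x] does the rest. *)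
Lemma derive_comm f x v w :
  (\forall y \near x, derivable f y v /\ derivable f y w) ->
  (\forall y \near x, derivable ('D_v f) y w /\ derivable ('D_w f) y v) ->
  {for x, continuous ('D_w ('D_v f))} -> {for x, continuous ('D_v ('D_w f))} ->
  'D_w ('D_v f) x = 'D_v ('D_w f) x.
Proof.
move=> d1 d2 c1 c2; apply/eqP; rewrite -subr_eq0 -normr_le0.
apply/ler_addgt0Pr => e e0; rewrite add0r.
have e20 : 0 < e / 2 by rewrite divr_gt0.
move/cvgrPdist_le : c1 => /(_ _ e20) c1.
move/cvgrPdist_le : c2 => /(_ _ e20) c2.
have [h h0 H] := near0_segment2 v w (filterI (filterI d1 d2) (filterI c1 c2)).
set A := (X in forall s t, _ -> _ -> X (_ + _)) in H.
have H' (t s : R) : `|t| <= h -> `|s| <= h -> A (x + t *: w + s *: v).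
  by move=> th sh; rewrite addrAC; apply: H.
have hE : `|h| = h by rewrite gtr0_norm.
have D1 (s t : R) : `|s| <= `|h| -> `|t| <= `|h| ->
     derivable f (x + s *: v + t *: w) v /\
     derivable ('D_v f) (x + s *: v + t *: w) w.
  rewrite hE => sh th; case: (H s t sh th) => -[a b] _.
  by split; [exact: a.1|exact: b.1].
have D2 (s t : R) : `|s| <= `|h| -> `|t| <= `|h| ->
     derivable f (x + s *: w + t *: v) w /\
     derivable ('D_w f) (x + s *: w + t *: v) v.
  rewrite hE => sh th; case: (H' s t sh th) => -[a b] _.
  by split; [exact: a.2|exact: b.2].
have [s [t [sh th E1]]] := second_difference D1.
have [t' [s' [th' sh' E2]]] := second_difference D2.
have L : f (x + h *: v + h *: w) - f (x + h *: v) - (f (x + h *: w) - f x) =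
    f (x + h *: w + h *: v) - f (x + h *: w) - (f (x + h *: v) - f x).
  by rewrite (addrAC x (h *: v)); ring.
have h0' := lt0r_neq0 h0.
have E := mulIf h0' (mulIf h0' (etrans (esym E1) (etrans L E2))).
rewrite hE in sh th sh' th'.
exact: distr_half2 (H s t sh th).2.1 (H' t' s' th' sh').2.2 E.
Qed.

End Schwarz.

Section Smooth.
Variables (R : realType) (m : nat) (U : set 'rV[R]_m).
Hypothesis Uo : open U.
Implicit Types (f : 'rV[R]_m -> R) (x v : 'rV[R]_m) (vs : seq 'rV[R]_m).

Lemma smooth_open_partial f i : smooth_open U f -> smooth_open U (partial f i).
Proof. by move=> sf s; exact: (sf (i :: s)). Qed.

Lemma smooth_open_continuous f x :
  smooth_open U f -> U x -> {for x, continuous f}.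
Proof. by move=> sf Ux; exact: (sf [::] x Ux).1. Qed.

Lemma smooth_open_derivable f x i :
  smooth_open U f -> U x -> derivable f x (delta_mx 0 i).
Proof. by move=> sf Ux; exact: (sf [::] x Ux).2. Qed.

(** Smoothness only speaks of coordinate directions. A general direction is assembled one coordinate
    at a time by [is_deriveDdir], whose continuity hypothesis is continuity of the partial
    derivatives. *)
Lemma smooth_open_is_derive f x v : smooth_open U f -> U x ->
  is_derive x v f (\sum_i v 0 i * partial f i x).
Proof.
move=> sf Ux; rewrite [X in is_derive x X](row_sum_delta v).
elim: (index_enum _) => [|i s IH]; first by rewrite !big_nil; exact: is_derive0.
rewrite !big_cons.
have dZ y : U y -> is_derive y (v 0 i *: delta_mx 0 i) f (v 0 i * partial f i y).
  by move=> Uy; apply: is_deriveZdir; exact: smooth_open_derivable.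
have nU : \forall y \near x, U y by exact: open_nbhs_nbhs.
rewrite -(@derive_val _ _ _ _ _ _ _ (dZ x Ux)) -(@derive_val _ _ _ _ _ _ _ IH).
apply: is_deriveDdir; last exact: ex_derive.
  by apply: filterS nU => y /dZ[].
have nE : \forall y \near x,
    v 0 i * partial f i y = 'D_(v 0 i *: delta_mx 0 i) f y.
  by apply: filterS nU => y /dZ[_ ->].
rewrite /prop_for /continuous_at -(nbhs_singleton nE).
apply: cvg_trans (near_eq_cvg nE) _.
apply: cvgM; first exact: cvg_cst.
exact: (smooth_open_continuous (smooth_open_partial i sf) Ux).
Qed.

Lemma partial_comm f i j x : smooth_open U f -> U x ->
  partial (partial f i) j x = partial (partial f j) i x.
Proof.
move=> sf Ux; have nU : \forall y \near x, U y by exact: open_nbhs_nbhs.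
apply: (@derive_comm _ _ f x (delta_mx 0 i) (delta_mx 0 j)).
- by apply: filterS nU => y Uy; split; exact: smooth_open_derivable sf Uy.
- apply: filterS nU => y Uy; split.
    exact: smooth_open_derivable (smooth_open_partial _ sf) Uy.
  exact: smooth_open_derivable (smooth_open_partial _ sf) Uy.
- exact: (sf [:: i; j] x Ux).1.
- exact: (sf [:: j; i] x Ux).1.
Qed.

End Smooth.

(* Directional derivatives through coordinates: [dirs [:: v1; ...; vk] f] is
   the k-linear form D^k f evaluated at v1, ..., vk. *)
Fixpoint dirs (R : realType) (m : nat) (vs : seq 'rV[R]_m)
    (f : 'rV[R]_m -> R) (x : 'rV[R]_m) : R :=
  if vs is v :: vs' then \sum_i v 0 i * dirs vs' (partial f i) x else f x.

Section Dirs.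
Variables (R : realType) (m : nat) (U : set 'rV[R]_m).
Hypothesis Uo : open U.
Implicit Types (f g : 'rV[R]_m -> R) (x v w : 'rV[R]_m) (vs ws : seq 'rV[R]_m).

Lemma partial_eq_in f g i :
  {in U, f =1 g} -> {in U, partial f i =1 partial g i}.
Proof.
move=> fg x /set_mem Ux; apply: near_eq_derive.
have : \forall y \near x, U y by exact: open_nbhs_nbhs.
by apply: filterS => y Uy; apply: fg; exact: mem_set.
Qed.

Lemma dirs_eq_in vs f g : {in U, f =1 g} -> {in U, dirs vs f =1 dirs vs g}.
Proof.
elim: vs f g => [//|v vs IH] f g fg x Ux /=; apply: eq_bigr => i _.
by congr (_ * _); apply: IH => //; exact: partial_eq_in.
Qed.

Lemma dirs_cons_congr v vs ws f x :
  (forall i, dirs vs (partial f i) x = dirs ws (partial f i) x) ->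
  dirs (v :: vs) f x = dirs (v :: ws) f x.
Proof. by move=> E /=; apply: eq_bigr => i _; rewrite E. Qed.

Lemma dirs_swap v w vs f x : smooth_open U f -> U x ->
  dirs [:: v, w & vs] f x = dirs [:: w, v & vs] f x.
Proof.
move=> sf Ux /=; under eq_bigr do rewrite mulr_sumr.
rewrite exchange_big /=; apply: eq_bigr => j _; rewrite [RHS]mulr_sumr.
apply: eq_bigr => i _.
have E : {in U, partial (partial f i) j =1 partial (partial f j) i}.
  by move=> y /set_mem Uy; exact: (partial_comm Uo i j sf Uy).
have {}E := dirs_eq_in vs E (mem_set Ux).
refine (etrans (mulrCA _ _ _) _).
refine (congr1 (fun z : R => w 0 j * (v 0 i * z)) E).
Qed.

Lemma dirs_middle vs v ws f x : smooth_open U f -> U x ->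
  dirs (vs ++ v :: ws) f x = dirs (v :: vs ++ ws) f x.
Proof.
elim: vs f => [//|w vs IH] f sf Ux; rewrite cat_cons [RHS]dirs_swap//.
by apply: dirs_cons_congr => i; exact: IH (smooth_open_partial i sf) Ux.
Qed.

(** This symmetry of D^k f later identifies derivatives of different Hessian entries along different
    frame vectors. *)
Lemma dirs_perm vs ws f x : smooth_open U f -> U x ->
  perm_eq vs ws -> dirs vs f x = dirs ws f x.
Proof.
elim: vs ws f => [|v vs IH] ws f sf Ux.
  by rewrite perm_sym => /perm_nilP ->.
move=> vw; have : v \in ws by rewrite -(perm_mem vw) mem_head.
move: vw => /[swap] /splitPr[s1 s2].
rewrite -[v :: s2]cat1s perm_sym perm_catCA perm_cons perm_sym dirs_middle// => vs12.
by apply: dirs_cons_congr => i; exact: IH (smooth_open_partial i sf) Ux vs12.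
Qed.

Lemma is_derive_dirs vs v f x : smooth_open U f -> U x ->
  is_derive x v (dirs vs f) (dirs (v :: vs) f x).
Proof.
(* With the new vector at the end of the list, it is the last differentiation, and the induction on
   [vs] passes through the coordinate sums. *)
move=> sf Ux; rewrite -[vs in dirs (_ :: vs)]cats0 -dirs_middle//.
elim: vs f sf => [|w vs IH] f sf; first exact: (smooth_open_is_derive Uo v sf Ux).
have -> : dirs (w :: vs) f = \sum_i (w 0 i \*: dirs vs (partial f i)).
  by apply/funext => y; rewrite fct_sumE.
by apply: is_derive_sum => i; apply: is_deriveZ; exact: IH (smooth_open_partial i sf).
Qed.

Lemma continuous_dirs vs f x : smooth_open U f -> U x ->
  {for x, continuous (dirs vs f)}.
Proof.
elim: vs f => [|w vs IH] f sf Ux; first exact: (smooth_open_continuous sf Ux).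
have -> : dirs (w :: vs) f = \sum_i (w 0 i \*: dirs vs (partial f i)).
  by apply/funext => y; rewrite fct_sumE.
elim: (index_enum _) => [|i s IHs]; first by rewrite big_nil; exact: cst_continuous.
rewrite big_cons; apply: continuousD; last exact: IHs.
apply: cvgZl_tmp; first exact: (nbhs_filter x).
exact: (IH _ (smooth_open_partial i sf) Ux).
Qed.

Lemma is_derive_dirs_line vs v f x (s : R) : smooth_open U f ->
  U (x + s *: v) ->
  is_derive s 1 (fun r : R => dirs vs f (x + r *: v))
    (dirs (v :: vs) f (x + s *: v)).
Proof.
move=> sf Us; have dv := is_derive_dirs vs v sf Us.
rewrite -(@derive_val _ _ _ _ _ _ _ dv).
by apply: is_derive_line; exact: ex_derive.
Qed.

End Dirs.

(** * Second order conditions *)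

Section Jets.
Variable R : realType.
Implicit Types (f g : R -> R) (a b : R).

(** The 2-jet of [f] at 0. The derivative [f1] is given on a neighbourhood, so that its own
    derivative at 0 makes sense. *)
Definition jet2 f a0 a1 a2 := exists f1 : R -> R,
  [/\ \forall s \near (0 : R), is_derive (s : R) 1 f (f1 s), is_derive (0 : R) 1 f1 a2,
      f 0 = a0 & f1 0 = a1].

Lemma jet2_cst a : jet2 (fun=> a) a 0 0.
Proof.
exists (fun=> 0); split; rewrite ?/=; [|exact: is_derive_cst|by []|by []].
by near=> s; exact: is_derive_cst.
Unshelve. all: by end_near. Qed.

Lemma jet2_id : jet2 id 0 1 0.
Proof.
exists (fun=> 1); split; [|exact: is_derive_cst|by []|by []].
by near=> s; exact: is_derive_id.
Unshelve. all: by end_near. Qed.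

Lemma jet2D f g a0 a1 a2 b0 b1 b2 : jet2 f a0 a1 a2 -> jet2 g b0 b1 b2 ->
  jet2 (fun s => f s + g s) (a0 + b0) (a1 + b1) (a2 + b2).
Proof.
move=> [f1 [df df1 <- <-]] [g1 [dg dg1 <- <-]].
exists (fun s => f1 s + g1 s); split => //; last exact: is_deriveD.
by apply: filterS2 df dg => s; exact: is_deriveD.
Qed.

Lemma jet2M f g a0 a1 a2 b0 b1 b2 : jet2 f a0 a1 a2 -> jet2 g b0 b1 b2 ->
  jet2 (fun s => f s * g s) (a0 * b0) (a0 * b1 + b0 * a1)
    (a0 * b2 + 2 * a1 * b1 + b0 * a2).
Proof.
move=> [f1 [df df1 <- <-]] [g1 [dg dg1 <- <-]].
exists (fun s => f s * g1 s + g s * f1 s); split => //.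
  by apply: filterS2 df dg => s; exact: is_deriveM.
have := is_deriveD (is_deriveM (nbhs_singleton df) dg1)
  (is_deriveM (nbhs_singleton dg) df1).
by move=> D; apply: is_derive_eq D _; rewrite /GRing.scale /=; ring.
Qed.

Lemma jet2N f a0 a1 a2 : jet2 f a0 a1 a2 ->
  jet2 (fun s => - f s) (- a0) (- a1) (- a2).
Proof.
move=> [f1 [df df1 <- <-]].
exists (fun s => - f1 s); split => //; last exact: is_deriveN.
by apply: filterS df => s; exact: is_deriveN.
Qed.

Lemma jet2_quadratic a b c : jet2 (fun s => a + (b * s + c * (s * s))) a b (2 * c).
Proof.
have := jet2D (jet2_cst a) (jet2D (jet2M (jet2_cst b) jet2_id)
  (jet2M (jet2_cst c) (jet2M jet2_id jet2_id))).
by congr jet2; ring.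
Qed.

(** The first condition is Fermat's. If [a2] were positive, [f1] would be positive just to the right
    of 0, and the mean value theorem would give a value above [f 0]. *)
Lemma jet2_max f a0 a1 a2 : jet2 f a0 a1 a2 ->
  (\forall s \near 0, f s <= a0) -> a1 = 0 /\ a2 <= 0.
Proof.
move=> [f1 [df df1 <- <-]] fmax.
have [e e0 H] := near0_segment (1 : R) (filterI df fmax).
have dfe (s : R) : `|s| <= e -> is_derive s 1 f (f1 s).
  by move=> /H[+ _]; rewrite add0r [s%:A]mulr1.
have fe (s : R) : `|s| <= e -> f s <= f 0.
  by move=> /H[_]; rewrite add0r [s%:A]mulr1.
have oo (s : R) : s \in `]- e, e[ -> `|s| <= e.
  by rewrite in_itv /= ler_norml => /andP[/ltW -> /ltW ->].
have f10 : f1 0 = 0.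
  have D0 : is_derive (0 : R) 1 f 0.
    apply: (@derive1_at_max R f (- e) e).
    - by rewrite ge0_cp// ltW.
    - by move=> t /oo/dfe[].
    - by rewrite in_itv /= oppr_lt0 e0.
    - by move=> t /oo/fe.
  have De : is_derive (0 : R) 1 f (f1 0) by apply: dfe; rewrite normr0 ltW.
  by rewrite -(@derive_val _ _ _ _ _ _ _ De) (@derive_val _ _ _ _ _ _ _ D0).
split=> //; rewrite leNgt; apply/negP => a20.
case: df1 => cf1 vf1.
have {cf1} : h^-1 *: ((f1 \o shift 0) (h *: 1) - f1 0) @[h --> 0^'] --> a2.
  by rewrite -vf1; exact: cf1.
move=> /cvgrPdist_lt/(_ _ a20)/nbhs_ballP[r /= r0 Hr].
have f1gt0 (s : R) : 0 < s -> s < r -> 0 < f1 s.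
  move=> s0 sr; have := Hr s; rewrite -ball_normE /= sub0r normrN gtr0_norm//.
  move=> /(_ sr (lt0r_neq0 s0)); rewrite addr0 [s%:A]mulr1 f10 subr0.
  rewrite ltr_norml => /andP[_]; rewrite ltrBlDr ltrDl.
  by rewrite -[_ *: _]/(_ * _) pmulr_rgt0// invr_gt0.
pose h := Num.min e (r / 2).
have h0 : 0 < h by rewrite lt_min e0 divr_gt0.
have he : h <= e by rewrite ge_min lexx.
have hr : h < r.
  by rewrite gt_min; apply/orP; right; rewrite ltr_pdivrMr// ltr_pMr// ltrDl.
have dh (s : R) : s \in `[0, h] -> is_derive s 1 f (f1 s).
  by rewrite in_itv /= => /andP[s0 sh]; apply: dfe; rewrite ger0_norm// (le_trans sh).
have dho (s : R) : s \in `]0, h[ -> is_derive s 1 f (f1 s).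
  by move=> /subset_itv_oo_cc; exact: dh.
have ch : {within `[0, h], continuous f}.
  by apply: derivable_within_continuous => s /dh[].
have [s + E] := MVT h0 dho ch; rewrite in_itv /= => /andP[s0 sh].
have : f h <= f 0 by apply: fe; rewrite gtr0_norm.
apply/negP; rewrite -ltNge -subr_gt0 E subr0 mulr_gt0//.
by rewrite f1gt0// (lt_trans sh).
Qed.

Lemma jet2_eq f a0 a1 a2 : jet2 f a0 a1 a2 ->
  (\forall s \near 0, f s = a0) -> a1 = 0 /\ a2 = 0.
Proof.
move=> jf fE.
have [|-> a2le] := jet2_max jf; first by apply: filterS fE => s ->.
have [|_] := jet2_max (jet2N jf); first by apply: filterS fE => s ->.
by rewrite oppr_le0 => a2ge; split => //; apply/eqP; rewrite eq_le a2le.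
Qed.

(* The constraint says that [v22 / (v11 v22 - v12^2)], the first entry of an
   inverse 2x2 matrix, is at most [K], with equality at 0. *)
Lemma inverse_entry_max (v11 v12 v22 K : R -> R)
    (a x1 x2 y1 y2 b z1 z2 k0 k1 k2 : R) :
  jet2 v11 a x1 x2 -> jet2 v12 0 y1 y2 -> jet2 v22 b z1 z2 ->
  jet2 K k0 k1 k2 -> 0 < a -> 0 < b -> k0 * a = 1 ->
  (\forall s \near 0, v22 s - K s * (v11 s * v22 s - v12 s * v12 s) <= 0) ->
  x1 = - k1 * a ^+ 2 /\
  2 * y1 ^+ 2 - k2 * a ^+ 2 * b + 2 * k1 ^+ 2 * a ^+ 3 * b <= x2 * b.
Proof.
move=> j11 j12 j22 jK a0 b0 k0a.
(* The constrained function vanishes at 0, because [k0 * a = 1] and [v12] vanishes there; hence 0 is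
   a local maximum. *)
move: (jet2D j22 (jet2N (jet2M jK (jet2D (jet2M j11 j22) (jet2N (jet2M j12 j12)))))).
move=> /jet2_max H hle.
have {H} [|E1 E2] := H.
  apply: filterS hle => s; rewrite !(mul0r, mulr0) oppr0 addr0 mulrA k0a mul1r.
  by rewrite subrr.
have k0E : k0 = a^-1 by rewrite -[k0](mulfK (lt0r_neq0 a0)) k0a mul1r.
have x1E : x1 = - k1 * a ^+ 2.
  apply: (mulIf (lt0r_neq0 b0)); apply: (mulfI (lt0r_neq0 (_ : 0 < k0))).
    by rewrite k0E invr_gt0.
  have : k0 * (x1 * b) + k1 * a * b = (1 - k0 * a) * z1 -
    (z1 + - (k0 * (a * z1 + b * x1 + - (0 * y1 + 0 * y1)) +
       (a * b + - (0 * 0)) * k1)) by ring.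
  rewrite E1 k0a subrr mul0r subr0 => E.
  have -> : k0 * (- k1 * a ^+ 2 * b) = - (k0 * a) * (k1 * a * b) by ring.
  by rewrite k0a mulN1r; apply/eqP; rewrite -addr_eq0 E.
split => //; move: E2; rewrite x1E => E2.
rewrite -subr_ge0.
(* The second order condition is multiplied by [- a]: [z2] cancels since [k0] is the inverse of [a],
   and [z1] cancels by the value found for [x1]. *)
have -> : x2 * b - (2 * y1 ^+ 2 - k2 * a ^+ 2 * b + 2 * k1 ^+ 2 * a ^+ 3 * b) =
  - a * (z2 + - (k0 * (a * z2 + 2 * (- k1 * a ^+ 2) * z1 + b * x2 +
     - (0 * y2 + 2 * y1 * y1 + 0 * y2)) +
     2 * k1 * (a * z1 + b * (- k1 * a ^+ 2) + - (0 * y1 + 0 * y1)) +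
     (a * b + - (0 * 0)) * k2)).
  by rewrite k0E; field; exact: lt0r_neq0.
by rewrite mulr_le0// oppr_le0 ltW.
Qed.

(** The determinant of a symmetric matrix is expanded to second order where the matrix is diagonal.
    Off-diagonal entries enter at least quadratically, so only their first derivatives remain. *)
Lemma det_eq (v11 v12 v13 v22 v23 v33 : R -> R)
    (a x1 x2 b z1 z2 c t1 t2 y12 y12' y13 y13' y23 y23' d : R) :
  jet2 v11 a x1 x2 -> jet2 v22 b z1 z2 -> jet2 v33 c t1 t2 ->
  jet2 v12 0 y12 y12' -> jet2 v13 0 y13 y13' -> jet2 v23 0 y23 y23' ->
  (\forall s \near 0, v11 s * (v22 s * v33 s - v23 s * v23 s)
    - v12 s * (v12 s * v33 s - v13 s * v23 s)
    + v13 s * (v12 s * v23 s - v13 s * v22 s) = d) ->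
  x1 * b * c + a * z1 * c + a * b * t1 = 0 /\
  x2 * b * c + a * z2 * c + a * b * t2
    + 2 * (x1 * z1 * c + x1 * t1 * b + z1 * t1 * a)
    - 2 * (y12 ^+ 2 * c + y13 ^+ 2 * b + y23 ^+ 2 * a) = 0.
Proof.
move=> j11 j22 j33 j12 j13 j23 hd.
have J := jet2D (jet2D (jet2M j11 (jet2D (jet2M j22 j33) (jet2N (jet2M j23 j23))))
   (jet2N (jet2M j12 (jet2D (jet2M j12 j33) (jet2N (jet2M j13 j23))))))
   (jet2M j13 (jet2D (jet2M j12 j23) (jet2N (jet2M j13 j22)))).
have [|E1 E2] := jet2_eq J.
  have [_ [_ _ + _]] := J; rewrite (nbhs_singleton hd) => <-; exact: hd.
by split; [rewrite -[RHS]E1|rewrite -[RHS]E2]; ring.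
Qed.

(* [tkij] and [qkkij] are the derivatives along [b_k] of the entry [ij]. *)
Lemma third_order_contradiction (a b c k1 delta t111 t112 t113 t122 t123 t133
    t211 t311 t212 t312 q1111 q1122 q1133 q2211 q3311 : R) :
  0 < a -> 0 < b -> 0 < c -> 0 < delta ->
  t211 = t112 -> t311 = t113 -> t212 = t122 -> t312 = t123 ->
  q1122 = q2211 -> q1133 = q3311 ->
  t111 = - 0 * a ^+ 2 /\
  2 * t112 ^+ 2 - 0 * a ^+ 2 * b + 2 * 0 ^+ 2 * a ^+ 3 * b <= q1111 * b ->
  t211 = - 0 * a ^+ 2 /\
  2 * t212 ^+ 2 - 0 * a ^+ 2 * b + 2 * 0 ^+ 2 * a ^+ 3 * b <= q2211 * b ->
  t311 = - k1 * a ^+ 2 /\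
  2 * t312 ^+ 2 - 2 * - delta * a ^+ 2 * b + 2 * k1 ^+ 2 * a ^+ 3 * b
    <= q3311 * b ->
  t111 * b * c + a * t122 * c + a * b * t133 = 0 /\
  q1111 * b * c + a * q1122 * c + a * b * q1133
    + 2 * (t111 * t122 * c + t111 * t133 * b + t122 * t133 * a)
    - 2 * (t112 ^+ 2 * c + t113 ^+ 2 * b + t123 ^+ 2 * a) = 0 ->
  False.
Proof.
move=> a0 b0 c0 delta0 e1 e2 -> -> -> -> [-> h1] [x2 h2] [x3 h3] [d1 d2].
(* Symmetry of third derivatives turns the first order conditions along [b2] and [b3] into values of
   [t112] and [t113]. *)
have t112E : t112 = 0 by rewrite -e1 x2 oppr0 mul0r.
have t113E : t113 = - k1 * a ^+ 2 by rewrite -e2.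
rewrite {}t112E {}t113E in h1 d2.
have h1' : 0 <= q1111.
  by rewrite -(pmulr_lge0 _ b0) (le_trans _ h1)// !(expr0n, mulr0, mul0r) subrr addr0.
(* Since [t111] vanishes, the equation differentiated once along [b1] ties [t133] to [t122]. *)
have t133E : t133 = - (t122 * c / b).
  apply: (mulfI (lt0r_neq0 (mulr_gt0 a0 b0))).
  have -> : a * b * - (t122 * c / b) = - (a * t122 * c).
    by field; exact: lt0r_neq0.
  by apply/eqP; rewrite -addr_eq0; apply/eqP; rewrite -[RHS]d1; ring.
(* Weighted by [b * c], [a * c] and [a * b], the three second order conditions add up to [b] times
   the twice differentiated equation. All quadratic terms in third derivatives cancel and only the
   [delta] term survives. *)
have : 2 * delta * a ^+ 3 * b ^+ 2 <= 0.
  have -> : 2 * delta * a ^+ 3 * b ^+ 2 =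
    - (b * c * (q1111 * b) + a * c * (q2211 * b - 2 * t122 ^+ 2) +
      a * b * (q3311 * b - (2 * t123 ^+ 2 - 2 * - delta * a ^+ 2 * b +
         2 * k1 ^+ 2 * a ^+ 3 * b))) +
    b * (q1111 * b * c + a * q2211 * c + a * b * q3311
      + 2 * (- 0 * a ^+ 2 * t122 * c + - 0 * a ^+ 2 * t133 * b + t122 * t133 * a)
      - 2 * (0 ^+ 2 * c + (- k1 * a ^+ 2) ^+ 2 * b + t123 ^+ 2 * a)).
    by rewrite t133E; field; exact: lt0r_neq0.
  rewrite d2 mulr0 addr0 oppr_le0 !addr_ge0// !mulr_ge0 ?(ltW a0, ltW b0, ltW c0)//.
    by rewrite subr_ge0 (le_trans _ h2)// !(expr0n, mulr0, mul0r) subr0 addr0.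
  by rewrite subr_ge0.
by apply/negP; rewrite -ltNge !mulr_gt0 ?exprn_gt0.
Qed.

End Jets.

(** * Second order conditions in an orthogonal frame *)

Section InteriorMaximum.
Variables (R : realType) (m : nat) (U : set 'rV[R]_m).
Hypothesis Uo : open U.

Lemma jet2_dirs vs v f (x : 'rV[R]_m) (c a : R) : smooth_open U f -> U x ->
  dirs vs f x + c = a ->
  jet2 (fun s => dirs vs f (x + s *: v) + c) a
    (dirs [:: v & vs] f x) (dirs [:: v, v & vs] f x).
Proof.
move=> sf Ux <-.
suff J : jet2 (fun s => dirs vs f (x + s *: v)) (dirs vs f x)
    (dirs [:: v & vs] f x) (dirs [:: v, v & vs] f x).
  by have := jet2D J (jet2_cst c); rewrite !addr0.
have x0 : x + 0 *: v = x by rewrite scale0r addr0.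
exists (fun s => dirs (v :: vs) f (x + s *: v)); split; rewrite ?x0//.
  have nU : nbhs x U by exact: open_nbhs_nbhs.
  have [e e0 H] := near0_segment v nU.
  apply/nbhs_ballP; exists e => //= s; rewrite -ball_normE /= sub0r normrN => se.
  by apply: (is_derive_dirs_line Uo vs sf); apply: H; exact: ltW.
have Ux0 : U (x + 0 *: v) by rewrite x0.
have := is_derive_dirs_line Uo (v :: vs) sf Ux0.
by rewrite [in X in is_derive _ _ _ X]x0.
Qed.

(** Where the 2x2 minor is positive, [psi K <= 0] bounds its quotient with [V22] by [K], that is,
    V22 / (V11 V22 - V12^2) <= K. The bound is constant along [b1] and [b2]; along [b3] it is
    strictly concave, which yields the contradiction. The constants [cij] leave room for the form of
    I_{n+1} and for [kappa]. *)
Lemma no_interior_max f (p b1 b2 b3 : 'rV[R]_m)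
    (c11 c12 c13 c22 c23 c33 k0 k1 delta d : R) :
  let V11 q := dirs [:: b1; b1] f q + c11 in
  let V12 q := dirs [:: b1; b2] f q + c12 in
  let V13 q := dirs [:: b1; b3] f q + c13 in
  let V22 q := dirs [:: b2; b2] f q + c22 in
  let V23 q := dirs [:: b2; b3] f q + c23 in
  let V33 q := dirs [:: b3; b3] f q + c33 in
  let psi K q := V22 q - K * (V11 q * V22 q - V12 q * V12 q) in
  smooth_open U f -> U p -> V12 p = 0 -> V13 p = 0 -> V23 p = 0 ->
  0 < V11 p -> 0 < V22 p -> 0 < V33 p -> k0 * V11 p = 1 -> 0 < delta ->
  (\forall s \near 0, psi k0 (p + s *: b1) <= 0) ->
  (\forall s \near 0, psi k0 (p + s *: b2) <= 0) ->
  (\forall s \near 0,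
    psi (k0 + (k1 * s + - delta * (s * s))) (p + s *: b3) <= 0) ->
  (\forall s \near 0, let q := p + s *: b1 in
    V11 q * (V22 q * V33 q - V23 q * V23 q)
    - V12 q * (V12 q * V33 q - V13 q * V23 q)
    + V13 q * (V12 q * V23 q - V13 q * V22 q) = d) ->
  False.
Proof.
move=> V11 V12 V13 V22 V23 V33 psi sf Up V12p V13p V23p a0 b0 c0 k0a delta0.
move=> max1 max2 max3 hd.
have j11 v := jet2_dirs v sf Up (erefl (V11 p)).
have j12 v := jet2_dirs v sf Up V12p.
have j13 v := jet2_dirs v sf Up V13p.
have j22 v := jet2_dirs v sf Up (erefl (V22 p)).
have j23 v := jet2_dirs v sf Up V23p.
have j33 v := jet2_dirs v sf Up (erefl (V33 p)).
have h1 := inverse_entry_max (j11 b1) (j12 b1) (j22 b1) (jet2_cst k0)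
  a0 b0 k0a max1.
have h2 := inverse_entry_max (j11 b2) (j12 b2) (j22 b2) (jet2_cst k0)
  a0 b0 k0a max2.
have h3 := inverse_entry_max (j11 b3) (j12 b3) (j22 b3)
  (jet2_quadratic k0 k1 (- delta)) a0 b0 k0a max3.
have hD := det_eq (j11 b1) (j22 b1) (j33 b1) (j12 b1) (j13 b1) (j23 b1) hd.
have P vs ws : perm_eq vs ws -> dirs vs f p = dirs ws f p.
  exact: (dirs_perm Uo sf Up).
(* The six identities left are symmetries of third and fourth derivatives; in each, the lists of
   directions differ by a rotation. *)
apply: (third_order_contradiction a0 b0 c0 delta0 _ _ _ _ _ _ h1 h2 h3 hD);
  apply: P.
- exact: permEl (perm_rot 2 [:: b1; b1; b2]).
- exact: permEl (perm_rot 2 [:: b1; b1; b3]).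
- exact: permEl (perm_rot 2 [:: b1; b2; b2]).
- exact: permEl (perm_rot 2 [:: b1; b2; b3]).
- exact: permEl (perm_rot 2 [:: b2; b2; b1; b1]).
- exact: permEl (perm_rot 2 [:: b3; b3; b1; b1]).
Qed.

End InteriorMaximum.

(** * Quadratic forms and frames *)

Section BilinearForm.
Variables (R : realType) (n : nat).
Implicit Types (A B : 'M[R]_n) (v w : 'rV[R]_n).

Definition bil A v w : R := (v *m A *m w^T) 0 0.

Lemma bilDl A v v' w : bil A (v + v') w = bil A v w + bil A v' w.
Proof. by rewrite /bil !mulmxDl mxE. Qed.

Lemma bilZl A k v w : bil A (k *: v) w = k * bil A v w.
Proof. by rewrite /bil -!scalemxAl mxE. Qed.

Lemma bilDr A v w w' : bil A v (w + w') = bil A v w + bil A v w'.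
Proof. by rewrite /bil linearD mulmxDr mxE. Qed.

Lemma bilZr A k v w : bil A v (k *: w) = k * bil A v w.
Proof. by rewrite /bil linearZ -scalemxAr mxE. Qed.

Lemma bil0l A w : bil A 0 w = 0.
Proof. by rewrite /bil !mul0mx mxE. Qed.

Lemma bil0r A v : bil A v 0 = 0.
Proof. by rewrite /bil trmx0 mulmx0 mxE. Qed.

Lemma bilC A v w : A^T = A -> bil A v w = bil A w v.
Proof.
move=> As; have : (w *m A *m v^T)^T = v *m A *m w^T.
  by rewrite !trmx_mul trmxK As mulmxA.
by rewrite /bil => <-; rewrite mxE.
Qed.

Lemma bil_add A B v w : bil (A + B) v w = bil A v w + bil B v w.
Proof. by rewrite /bil mulmxDr mulmxDl mxE. Qed.

Lemma bil_opp A v w : bil (- A) v w = - bil A v w.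
Proof. by rewrite /bil mulmxN mulNmx mxE. Qed.

Lemma bil_scale A k v w : bil (k *: A) v w = k * bil A v w.
Proof. by rewrite /bil -scalemxAr -scalemxAl mxE. Qed.

Lemma bil_sum A v w : bil A v w = \sum_i v 0 i * \sum_j w 0 j * A i j.
Proof.
rewrite /bil mxE; under eq_bigr do rewrite !mxE mulr_suml.
rewrite exchange_big; apply: eq_bigr => i _; rewrite mulr_sumr.
by apply: eq_bigr => j _; rewrite -mulrA (mulrC (A i j)).
Qed.

Lemma bil1E v w : bil 1%:M v w = \sum_i v 0 i * w 0 i.
Proof. by rewrite /bil mulmx1 mxE; apply: eq_bigr => i _; rewrite mxE. Qed.

Lemma bil1_gt0 v : v != 0 -> 0 < bil 1%:M v v.
Proof.
move=> v0; rewrite bil1E; under eq_bigr do rewrite -expr2.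
rewrite lt_neqAle sumr_ge0 ?andbT; last by move=> i _; exact: sqr_ge0.
apply: contra v0; rewrite eq_sym psumr_eq0; last by move=> i _; exact: sqr_ge0.
move=> /allP v0; apply/eqP/rowP => i; rewrite mxE.
by have := v0 i (mem_index_enum i); rewrite /= sqrf_eq0 => /eqP.
Qed.

(** A zero of a nonnegative form is a minimum. Moving from [v] along any [w] then forces A(v,w) = 0,
    so [v] would lie in the kernel. *)
Lemma psd_bil_gt0 A v : psdmx A -> \det A != 0 -> v != 0 -> 0 < bil A v v.
Proof.
move=> [As Apos] dA v0; rewrite lt_neqAle Apos andbT eq_sym.
apply: contra dA => /eqP Avv.
have Avw w : bil A v w = 0.
  have P (s : R) : 0 <= 2 * s * bil A v w + s ^+ 2 * bil A w w.
    have := Apos (v + s *: w); rewrite -/(bil A _ _) bilDl !bilDr Avv add0r.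
    by rewrite bilZl !bilZr bilZl (bilC w v As); congr (0 <= _); ring.
  apply/eqP/contraT => Bn0; set B := bil A v w in P Bn0.
  have C0 : 0 <= bil A w w := Apos w.
  have C1 : 0 < bil A w w + 1 by rewrite ltr_wpDl.
  (* The added 1 keeps the denominator positive when [bil A w w] is zero. *)
  have := P (- (B / (bil A w w + 1))).
  have -> : 2 * - (B / (bil A w w + 1)) * B +
      (- (B / (bil A w w + 1))) ^+ 2 * bil A w w =
    - (B / (bil A w w + 1)) ^+ 2 * (bil A w w + 2).
    by field; exact: lt0r_neq0.
  rewrite mulNr oppr_ge0 leNgt mulr_gt0// ?ltr_wpDl// exprn_even_gt0//.
  by rewrite mulf_neq0// invr_eq0 gt_eqF.
apply/det0P; exists v => //; apply/rowP => j.
have := Avw (delta_mx 0 j); rewrite /bil trmx_delta -colE mxE => ->.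
by rewrite mxE.
Qed.

End BilinearForm.

Section FrameDeterminant.
Variable R : realType.

Lemma det_nat3 (E : nat -> nat -> R) :
  \det (\matrix_(i < 3, j < 3) E i j) =
    E 0 0 * (E 1 1 * E 2 2 - E 1 2 * E 2 1)
    - E 0 1 * (E 1 0 * E 2 2 - E 1 2 * E 2 0)
    + E 0 2 * (E 1 0 * E 2 1 - E 1 1 * E 2 0).
Proof.
rewrite (expand_det_row _ ord0) !big_ord_recl big_ord0 /cofactor.
rewrite !(expand_det_row _ ord0) !big_ord_recl !big_ord0 /cofactor !det_mx11 !mxE /=.
rewrite /bump /=; ring.
Qed.

Lemma det_nat2 (E : nat -> nat -> R) :
  \det (\matrix_(i < 2, j < 2) E i j) = E 0 0 * E 1 1 - E 0 1 * E 1 0.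
Proof.
rewrite (expand_det_row _ ord0) !big_ord_recl big_ord0 /cofactor !det_mx11 !mxE /=.
rewrite /bump /=; ring.
Qed.

(** The Gram matrix factors as S A S^T. In a fixed frame the equation therefore still prescribes a
    constant determinant. *)
Lemma det_bil n (A : 'M[R]_n) (s : nat -> 'rV[R]_n) :
  \det (\matrix_(i < n, j < n) bil A (s i) (s j)) =
  (\det (\matrix_(i < n) s i)) ^+ 2 * \det A.
Proof.
have -> : \matrix_(i < n, j < n) bil A (s i) (s j) =
    (\matrix_(i < n) s i) *m A *m (\matrix_(i < n) s i)^T.
  apply/matrixP => i j; rewrite mxE /bil.
  rewrite -[in LHS](rowK s i) -[in LHS](rowK s j) -!row_mul.
  rewrite !mxE; apply: eq_bigr => k _.
  by rewrite !mxE; congr (_ * _); apply: eq_bigr => l _; rewrite !mxE.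
by rewrite !det_mulmx det_tr expr2 mulrAC.
Qed.

End FrameDeterminant.

Section Hessian.
Variable R : realType.

Lemma bil_hessian m (f : 'rV[R]_m -> R) x v w :
  bil (hessian f x) v w = dirs [:: v; w] f x.
Proof.
rewrite bil_sum; apply: eq_bigr => i _; congr (_ * _); apply: eq_bigr => j _.
by rewrite mxE.
Qed.

Lemma hessian_near m (f g : 'rV[R]_m -> R) x :
  (\forall y \near x, f y = g y) -> hessian f x = hessian g x.
Proof.
move=> fg; apply/matrixP => i j; rewrite [LHS]mxE [RHS]mxE.
apply: near_eq_derive; apply: filterS (nbhs_interior fg) => y fgy.
exact: near_eq_derive.
Qed.

Lemma hessian_tr m (U : set 'rV[R]_m) (f : 'rV[R]_m -> R) x :
  open U -> smooth_open U f -> U x -> (hessian f x)^T = hessian f x.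
Proof.
move=> Uo sf Ux; apply/matrixP => i j; rewrite 2!mxE [RHS]mxE.
exact: (partial_comm Uo _ _ sf Ux).
Qed.

Lemma bil_space_id n (a b : 'rV[R]_n) (s t : 'M[R]_1) :
  bil (space_id R n) (row_mx a s) (row_mx b t) = bil 1%:M a b.
Proof.
rewrite /bil /space_id mul_row_block tr_row_mx !mulmx0 !addr0 mul_row_col.
by rewrite mul0mx addr0.
Qed.

(* The frame of [f] completes [g] to an orthogonal basis of the plane; on the
   line there is nothing to add, and the constant [kappa = 1] stands for the
   missing diagonal entry. *)
Lemma frame_exists n (g : 'rV[R]_n) : n = 1%N \/ n = 2%N -> g != 0 ->
  exists f : 'rV[R]_n, exists kappa : R,
  [/\ bil 1%:M g f = 0, (f != 0 /\ kappa = 0) \/ (f = 0 /\ kappa = 1) &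
    forall b1 b3 : 'rV[R]_(n + 1), exists d : R,
    forall H : 'M[R]_(n + 1), H^T = H ->
    let b2 := row_mx f 0 in
    bil H b1 b1 * ((bil H b2 b2 + kappa) * bil H b3 b3 - bil H b2 b3 * bil H b2 b3)
    - bil H b1 b2 * (bil H b1 b2 * bil H b3 b3 - bil H b1 b3 * bil H b2 b3)
    + bil H b1 b3 * (bil H b1 b2 * bil H b2 b3
                     - bil H b1 b3 * (bil H b2 b2 + kappa)) = d * \det H].
Proof.
case=> n_eq; subst n => g0.
  (* With a zero middle vector and diagonal entry 1, the 3x3 expression reduces to the Gram
     determinant of [b1] and [b3]. *)
  exists 0, 1; split; [exact: bil0r|by right|move=> b1 b3].
  pose s := nth (0 : 'rV[R]_(1 + 1)) [:: b1; b3].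
  exists ((\det (\matrix_(i < 1 + 1) s i)) ^+ 2) => H Hs b2.
  have -> : b2 = 0 by exact: row_mx0.
  rewrite -det_bil (det_nat2 (fun i j => bil H (s i) (s j))) /= !bil0l !bil0r.
  by rewrite (bilC b3 b1 Hs); ring.
pose i1 : 'I_2 := lift ord0 ord0.
have i1E (i : 'I_2) : i = ord0 \/ i = i1.
  by case: (unliftP ord0 i) => [j|] ->; [right; rewrite (ord1 j)|left].
(* In the plane, [f] is [g] turned by a right angle. *)
pose f : 'rV[R]_2 := \row_j (if j == ord0 then - g 0 i1 else g 0 ord0).
have f00 : f 0 ord0 = - g 0 i1 by rewrite mxE.
have f01 : f 0 i1 = g 0 ord0 by rewrite mxE.
exists f, 0; split.
- rewrite bil1E !big_ord_recl big_ord0 -/i1 f00 f01; ring.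
- left; split => //; apply: contra g0 => /eqP f0.
  apply/eqP/rowP => i; rewrite mxE; case: (i1E i) => ->.
    by rewrite -f01 f0 mxE.
  by rewrite -[LHS]opprK -f00 f0 mxE oppr0.
move=> b1 b3.
pose s := nth (0 : 'rV[R]_(2 + 1)) [:: b1; row_mx f 0; b3].
exists ((\det (\matrix_(i < 2 + 1) s i)) ^+ 2) => H Hs b2.
rewrite -det_bil (det_nat3 (fun i j => bil H (s i) (s j))) /=.
by rewrite -/b2 (bilC b3 b1 Hs) (bilC b3 b2 Hs) (bilC b2 b1 Hs); ring.
Qed.

End Hessian.

(** * The frame at an interior maximum *)

Section InteriorContradiction.
Variables (R : realType) (n : nat) (V : set 'rV[R]_(n + 1)).
Hypothesis Vo : open V.

(** Gram-Schmidt for [H p] turns [g'], [f'] and the time vector into an orthogonal frame [b1], [f'],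
    [b3]. The first two are purely spatial and [b3] has time component 1, so the [delta] term is
    felt along [b3] only. *)
Lemma interior_max_contradiction (F : 'rV[R]_(n + 1) -> R)
    (p : 'rV[R]_(n + 1)) (eps delta kappa : R) (g f : 'rV[R]_n) :
  let H q := hessian F q + space_id R n in
  let g' := row_mx g 0 in
  let f' := row_mx f 0 in
  let N q := bil (H q) f' f' + kappa in
  let D q := bil (H q) g' g' * N q - bil (H q) g' f' ^+ 2 in
  let t (q : 'rV[R]_(n + 1)) := q 0 (rshift n 0) in
  smooth_open V F -> V p -> psdmx (H p) ->
  0 < eps -> (forall q, V q -> \det (H q) = eps) ->
  kappa = 0 \/ f = 0 ->
  (forall b1 b3 : 'rV[R]_(n + 1), exists d : R,
    forall H : 'M[R]_(n + 1), H^T = H ->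
    let b2 := row_mx f 0 in
    bil H b1 b1 * ((bil H b2 b2 + kappa) * bil H b3 b3 - bil H b2 b3 * bil H b2 b3)
    - bil H b1 b2 * (bil H b1 b2 * bil H b3 b3 - bil H b1 b3 * bil H b2 b3)
    + bil H b1 b3 * (bil H b1 b2 * bil H b2 b3
                     - bil H b1 b3 * (bil H b2 b2 + kappa)) = d * \det H) ->
  0 < N p -> 0 < D p -> 0 < delta ->
  (forall q, V q -> N q <= (N p / D p - delta * (t q ^+ 2 - t p ^+ 2)) * D q) ->
  False.
Proof.
move=> H g' f' N D t sF Vp psdHp eps0 detH kf detV Np0 Dp0 delta0 pmax.
have SH q : V q -> (H q)^T = H q.
  move=> Vq; rewrite /H linearD /= (hessian_tr Vo sF Vq).
  by rewrite /space_id tr_block_mx tr_scalar_mx !trmx0.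
have HE a b q : dirs [:: a; b] F q + bil (space_id R n) a b = bil (H q) a b.
  by rewrite bil_add bil_hessian.
have f'0 : f = 0 -> f' = 0 by rewrite /f' => ->; exact: row_mx0.
pose mu := - bil (H p) g' f' / N p.
pose b1 := g' + mu *: f'.
pose e : 'rV[R]_(n + 1) := row_mx 0 1%:M.
pose al := - bil (H p) b1 e / bil (H p) b1 b1.
pose be := - bil (H p) f' e / N p.
pose b3 := e + (al *: b1 + be *: f').
have Np_neq0 := lt0r_neq0 Np0.
have V12 : bil (H p) b1 f' = 0.
  rewrite bilDl bilZl /mu; case: kf => [k0|/f'0 ->]; last by rewrite !bil0r mulr0 addr0.
  have -> : bil (H p) f' f' = N p by rewrite /N k0 addr0.
  by rewrite divfK// subrr.
have k23 : kappa * bil (H p) f' e = 0.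
  by case: kf => [->|/f'0 ->]; rewrite ?mul0r// bil0l mulr0.
(* Adding a multiple of [f'] to [g'] does not change the 2x2 Gram determinant. Where [kappa] could
   spoil this, [f'] is zero. *)
have DE q : V q -> bil (H q) b1 b1 * N q - bil (H q) b1 f' * bil (H q) b1 f' = D q.
  move=> Vq.
  have D1 : bil (H q) b1 f' = bil (H q) g' f' + mu * bil (H q) f' f'.
    by rewrite bilDl bilZl.
  have D2 : bil (H q) b1 b1 = bil (H q) g' g' + 2 * mu * bil (H q) g' f' +
      mu ^+ 2 * bil (H q) f' f'.
    rewrite bilDr !bilDl !bilZr !bilZl (bilC f' g' (SH q Vq)); ring.
  case: kf => [k0|/f'0 f0].
    by rewrite D1 D2 /D /N k0 !addr0; ring.
  by rewrite D1 D2 /D /N f0 !bil0r; ring.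
have V11 : 0 < bil (H p) b1 b1.
  by rewrite -(pmulr_lgt0 _ Np0); have := DE p Vp; rewrite V12 mulr0 subr0 => ->.
have V11_neq0 := lt0r_neq0 V11.
have V13 : bil (H p) b1 b3 = 0.
  by rewrite !bilDr !bilZr V12 mulr0 addr0 /al divfK// subrr.
have V23 : bil (H p) f' b3 = 0.
  rewrite !bilDr !bilZr (bilC f' b1 (SH p Vp)) V12 mulr0 add0r /be.
  have -> : bil (H p) f' f' = N p - kappa by rewrite /N addrK.
  have -> : bil (H p) f' e + - bil (H p) f' e / N p * (N p - kappa) =
    kappa * bil (H p) f' e / N p by field.
  by rewrite k23 mul0r.
have tD (v w : 'rV[R]_(n + 1)) : t (v + w) = t v + t w by rewrite /t mxE.
have tZ k (v : 'rV[R]_(n + 1)) : t (k *: v) = k * t v by rewrite /t mxE.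
have tg : t g' = 0 by rewrite /t row_mxEr mxE.
have tf : t f' = 0 by rewrite /t row_mxEr mxE.
have tb1 : t b1 = 0 by rewrite tD tZ tg tf mulr0 addr0.
have tb3 : t b3 = 1.
  by rewrite !tD !tZ tb1 tf /t row_mxEr mxE !mulr0 !addr0.
have V33 : 0 < bil (H p) b3 b3.
  apply: psd_bil_gt0 => //; first by rewrite detH// gt_eqF.
  by apply/negP => /eqP b30; move: tb3; rewrite b30 /t mxE => /eqP; rewrite eq_sym oner_eq0.
have NE q : dirs [:: f'; f'] F q + (bil (space_id R n) f' f' + kappa) = N q.
  by rewrite addrA HE.
have psiE K q : V q -> N q - K * (bil (H q) b1 b1 * N q -
    bil (H q) b1 f' * bil (H q) b1 f') <= 0 <-> N q <= K * D q.
  by move=> Vq; rewrite DE// subr_le0.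
have [d Hd] := detV b1 b3.
have nV v : \forall s \near (0 : R), V (p + s *: v).
  have [r r0 Hr] := near0_segment v (open_nbhs_nbhs (conj Vo Vp)).
  apply/nbhs_ballP; exists r => //= s; rewrite -ball_normE /= sub0r normrN => sr.
  exact/Hr/ltW.
(* The slope [- (2 * delta * t p)] comes from expanding (t p + s)^2 - (t p)^2, and [d * eps] is the
   determinant in the frame. *)
apply: (@no_interior_max _ _ V Vo F p b1 f' b3 (bil (space_id R n) b1 b1)
  (bil (space_id R n) b1 f') (bil (space_id R n) b1 b3)
  (bil (space_id R n) f' f' + kappa) (bil (space_id R n) f' b3)
  (bil (space_id R n) b3 b3) (N p / D p) (- (2 * delta * t p)) delta (d * eps));
  rewrite ?NE ?HE //.
- by have := DE p Vp; rewrite V12 mulr0 subr0 => <-; field; rewrite Np_neq0.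
- apply: filterS (nV b1) => s Vs; rewrite NE !HE; apply/(psiE _ _ Vs).
  have := pmax _ Vs; rewrite tD tZ tb1 mulr0 addr0 subrr mulr0 subr0; exact.
- apply: filterS (nV f') => s Vs; rewrite NE !HE; apply/(psiE _ _ Vs).
  have := pmax _ Vs; rewrite tD tZ tf mulr0 addr0 subrr mulr0 subr0; exact.
- apply: filterS (nV b3) => s Vs; rewrite NE !HE; apply/(psiE _ _ Vs).
  have := pmax _ Vs; rewrite tD tZ tb3 => Hm; apply: le_trans Hm _.
  by rewrite le_eqVlt; apply/orP; left; apply/eqP; congr (_ * _); ring.
apply: filterS (nV b1) => s Vs /=; rewrite NE !HE.
by have := Hd _ (SH _ Vs); rewrite /= detH.
Qed.

End InteriorContradiction.

(** * The spatial Hessian on the slab *)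

Section Slices.
Variables (R : realType) (n : nat).
Implicit Types (F u : 'rV[R]_(n + 1) -> R) (x a b : 'rV[R]_n) (t : R).
Implicit Types (p q : 'rV[R]_(n + 1)).

Definition place p : 'rV[R]_n := lsubmx p.
Definition time p : R := p 0 (rshift n 0).

Lemma place_spacetime x t : place (spacetime x t) = x.
Proof. exact: row_mxKl. Qed.

Lemma time_spacetime x t : time (spacetime x t) = t.
Proof. by rewrite /time row_mxEr mxE eqxx mulr1n. Qed.

Lemma spacetimeK p : spacetime (place p) (time p) = p.
Proof.
rewrite /spacetime -[RHS]hsubmxK; congr row_mx.
by apply/rowP => i; rewrite (ord1 i) !mxE eqxx mulr1n.
Qed.

Lemma closed_slabP p : closed_slab p <-> 0 <= time p <= 1.
Proof.
split=> [[x [t [t01 ->]]]|t01]; first by rewrite time_spacetime.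
by exists (place p), (time p); rewrite spacetimeK.
Qed.

Lemma near_spacetime x t (A : set 'rV[R]_(n + 1)) :
  nbhs (spacetime x t) A -> \forall y \near x, A (spacetime y t).
Proof.
move=> /nbhs_ballP[r /= r0 rA]; apply/nbhs_ballP; exists r => //= y [_ xy].
apply: rA; split=> // i j; rewrite (ord1 i); case: (split_ordP j) => k ->.
  by rewrite !row_mxEl; exact: xy.
by rewrite !row_mxEr; exact: ballxx.
Qed.

Lemma partial_slice F t i :
  partial (slice F t) i = slice (partial F (lshift 1 i)) t.
Proof.
apply/funext => x.
have E : (fun h : R => h^-1 *: ((slice F t \o shift x) (h *: delta_mx 0 i)
    - slice F t x)) =
  (fun h : R => h^-1 *: ((F \o shift (spacetime x t))
    (h *: delta_mx 0 (lshift 1 i)) - F (spacetime x t))).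
  apply/funext => h /=; congr (_ *: (F _ - _)).
  by rewrite delta_mx_lshift scale_row_mx scaler0 add_row_mx add0r.
exact: (congr1 (fun G : R -> R => lim (G @ 0^')) E).
Qed.

Lemma hessian_slice F x t :
  hessian (slice F t) x = ulsubmx (hessian F (spacetime x t)).
Proof.
apply/matrixP => i j; rewrite [LHS]mxE /= /partials /= !partial_slice.
by rewrite 3!mxE.
Qed.

(** The form A of the spatial problem. Going through the slice at a fixed time uses values of [u] on
    the slab only, even at times 0 and 1, where the full Hessian would see values outside. *)
Definition space_form u a b p : R :=
  bil (hessian (slice u (time p)) (place p) + 1%:M) a b.

Lemma space_formE F a b p : space_form F a b p =
  bil (hessian F p + space_id R n) (row_mx a 0) (row_mx b 0).
Proof.
rewrite /space_form !bil_add bil_space_id; congr (_ + _).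
rewrite hessian_slice spacetimeK /bil -{2}[hessian F p]submxK.
rewrite mul_row_block !mul0mx !addr0 tr_row_mx mul_row_col trmx0 mulmx0 addr0.
by [].
Qed.

Lemma space_form_near F u a b p :
  (\forall y \near place p, slice F (time p) y = slice u (time p) y) ->
  space_form F a b p = space_form u a b p.
Proof. by move=> Fu; rewrite /space_form (hessian_near Fu). Qed.

(** Spatial displacements at a fixed time stay in the slab, so agreement there suffices, boundary
    times included. *)
Lemma space_form_local u F (U : set 'rV[R]_(n + 1)) a b q : open U ->
  (forall p, (@closed_slab R n `&` U) p -> F p = u p) ->
  closed_slab q -> U q -> space_form F a b q = space_form u a b q.
Proof.
move=> Uo Fu sq Uq; apply: space_form_near.
have : nbhs (spacetime (place q) (time q)) U.
  by rewrite spacetimeK; exact: open_nbhs_nbhs.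
move=> /near_spacetime; apply: filterS => y Uy; apply: Fu; split => //.
by apply/closed_slabP; rewrite time_spacetime; exact/closed_slabP.
Qed.

(** Near [p] the form is that of a smooth local extension, whose second derivatives are continuous
    across the boundary. *)
Lemma space_form_continuous u a b p : smooth_on (@closed_slab R n) u ->
  closed_slab p ->
  space_form u a b @ within (@closed_slab R n) (nbhs p) --> space_form u a b p.
Proof.
move=> su sp; have [U [F [Uo Up sF Fu]]] := su p sp.
have E q : closed_slab q -> U q ->
    dirs [:: row_mx a 0; row_mx b 0] F q + bil 1%:M a b = space_form u a b q.
  move=> sq Uq; rewrite -(space_form_local a b Uo Fu sq Uq) space_formE.
  by rewrite bil_add bil_space_id bil_hessian.
rewrite -(E p sp Up).
have nE : \forall q \near within (@closed_slab R n) (nbhs p),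
    dirs [:: row_mx a 0; row_mx b 0] F q + bil 1%:M a b = space_form u a b q.
  rewrite near_withinE; have : \forall q \near p, U q by exact: open_nbhs_nbhs.
  by apply: filterS => q Uq sq; exact: E.
apply: cvg_trans (near_eq_cvg nE) _.
apply: cvgD; last exact: cvg_cst.
apply: (@cvg_within_filter _ _ _ _ (nbhs_filter p)).
exact: (continuous_dirs sF Up).
Qed.

Lemma partial_translate m (f : 'rV[R]_m -> R) (c : 'rV[R]_m) i :
  periodic f c -> periodic (partial f i) c.
Proof.
move=> fc x.
have E : (fun h : R => h^-1 *: ((f \o shift (x + c)) (h *: delta_mx 0 i)
    - f (x + c))) =
  (fun h : R => h^-1 *: ((f \o shift x) (h *: delta_mx 0 i) - f x)).
  by apply/funext => h /=; rewrite addrA !fc.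
exact: (congr1 (fun G : R -> R => lim (G @ 0^')) E).
Qed.

Lemma space_form_periodic u a b (z : 'rV[int]_n) p :
  torus_periodic (slice u (time p)) ->
  space_form u a b (p + row_mx (map_mx intr z) 0) = space_form u a b p.
Proof.
move=> /(_ z) up.
have tp : time (p + row_mx (map_mx intr z) 0) = time p.
  by rewrite /time mxE row_mxEr mxE addr0.
have xp : place (p + row_mx (map_mx intr z) 0) = place p + map_mx intr z.
  by rewrite /place linearD /= row_mxKl.
suff E : hessian (slice u (time p)) (place p + map_mx intr z) =
    hessian (slice u (time p)) (place p).
  by rewrite /space_form tp xp E.
apply/matrixP => i j; rewrite [LHS]mxE [RHS]mxE.
exact: (partial_translate j (partial_translate i up)).
Qed.

End Slices.

(** * From a lower bound on A to an upper bound on the quotient *)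

Section PlaneFrame.
Variables (R : realType) (n : nat) (A : 'M[R]_n) (g f : 'rV[R]_n) (kappa : R).
Hypotheses (As : A^T = A) (g0 : g != 0) (gf : bil 1%:M g f = 0).
Hypothesis frame : (f != 0 /\ kappa = 0) \/ (f = 0 /\ kappa = 1).

Let N := bil A f f + kappa.
Let D := bil A g g * N - bil A g f ^+ 2.
(** By the choice of [kappa], [h] is orthogonal to [f] for [A]; in the plane, with [A] invertible,
    it is a multiple of A^-1 applied to [g]. *)
Let h := N *: g + (- bil A g f) *: f.

Lemma frame_form : bil A h h = N * D.
Proof.
rewrite /h bilDl !bilDr !bilZl !bilZr (bilC f g As).
have k0 : kappa * bil A g f = 0.
  by case: frame => -[f0 ->]; rewrite ?mul0r// f0 bil0r mulr0.
have -> : bil A f f = N - kappa by rewrite /N addrK.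
transitivity (N * D - bil A g f * (kappa * bil A g f)); last first.
  by rewrite k0 mulr0 subr0.
by rewrite /D; ring.
Qed.

Lemma frame_norm : N ^+ 2 * bil 1%:M g g <= bil 1%:M h h.
Proof.
have fg : bil 1%:M f g = 0 by rewrite bilC ?trmx1.
rewrite /h bilDl !bilDr !bilZl !bilZr gf fg !mulr0 addr0 add0r mulrA -expr2.
rewrite lerDl mulrA -expr2 mulr_ge0 ?sqr_ge0// bil1E sumr_ge0// => i _.
by rewrite -expr2 sqr_ge0.
Qed.

Hypothesis Apos : forall a, a != 0 -> 0 < bil A a a.

Lemma frame_gt0 : 0 < N.
Proof.
rewrite /N; case: frame => -[f0 ->]; first by rewrite addr0 Apos.
by rewrite f0 bil0r add0r.
Qed.

Lemma frame_det_gt0 : 0 < D.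
Proof.
rewrite -(pmulr_rgt0 _ frame_gt0) -frame_form Apos//.
apply/negP => /eqP h0; have := frame_norm; rewrite h0 bil0l.
by apply/negP; rewrite -ltNge mulr_gt0// ?exprn_gt0 ?frame_gt0// bil1_gt0.
Qed.

(** The lower bound on [A] is tested on [h], where A(h,h) = N D and |h|^2 >= N^2 |g|^2; then [N] is
    divided out. *)
Lemma frame_lower_bound (lambda : R) : 0 < lambda ->
  (forall a, lambda * bil 1%:M a a <= bil A a a) ->
  lambda * bil 1%:M g g * N <= D.
Proof.
move=> l0 Al; rewrite -(ler_pM2l frame_gt0) -frame_form (le_trans _ (Al h))//.
have -> : N * (lambda * bil 1%:M g g * N) = lambda * (N ^+ 2 * bil 1%:M g g).
  by ring.
by rewrite ler_pM2l// frame_norm.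
Qed.

End PlaneFrame.

(** * Maxima of periodic functions on the slab *)

Section Slab.
Variables (R : realType) (n : nat).
Implicit Types (p q : 'rV[R]_(n + 1)) (w : 'rV[R]_(n + 1) -> R).

Definition box : set 'rV[R]_(n + 1) := [set v | forall i, `[0, 1]%classic (v 0 i)].

Lemma box_slab : box `<=` @closed_slab R n.
Proof. by move=> v /(_ (rshift n 0)) /=; rewrite in_itv => ?; apply/closed_slabP. Qed.

Lemma shift_into_box p : closed_slab p ->
  exists z : 'rV[int]_n, box (p + row_mx (map_mx intr z) 0).
Proof.
move=> /closed_slabP p01; exists (\row_j - Num.floor (p 0 (lshift 1 j))).
move=> i /=; rewrite in_itv /= mxE; case: (split_ordP i) => j ->.
  rewrite row_mxEl !mxE rmorphN /= subr_ge0 floor_le /=.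
  have := floorD1_gt (p 0 (lshift 1 j)); rewrite rmorphD /= => /ltW.
  by rewrite lerBlDl.
by rewrite row_mxEr mxE addr0 (ord1 j).
Qed.

(** The slab is not compact, but integer translations in space bring each of its points into the
    compact [box]. *)
Lemma slab_max w :
  (forall p, closed_slab p -> w @ within (@closed_slab R n) (nbhs p) --> w p) ->
  (forall p (z : 'rV[int]_n), closed_slab p ->
     w (p + row_mx (map_mx intr z) 0) = w p) ->
  exists2 p, closed_slab p & forall q, closed_slab q -> w q <= w p.
Proof.
move=> wc wp.
have bc : compact box.
  exact: (@rV_compact R (n + 1) (fun=> `[0, 1]%classic) (fun=> @segment_compact R 0 1)).
have b0 : box !=set0 by exists 0 => i /=; rewrite mxE in_itv /= lexx ler01.
have wb : {within box, continuous w}.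
  apply/subspace_continuousP => p bp.
  apply: cvg_trans (wc p (box_slab bp)).
  by apply: cvg_app; exact: (within_subset _ box_slab).
have [p /set_mem bp pmax] := compact_EVT_max b0 bc wb.
exists p; first exact: box_slab.
move=> q sq; have [z bz] := shift_into_box sq.
by rewrite -(wp q z sq) pmax// mem_set.
Qed.

Lemma time_continuous : continuous (@time R n).
Proof. exact: coord_continuous. Qed.

End Slab.

(** * The estimate by contradiction *)

Section MainEstimate.
Variables (R : realType) (n : nat) (eps lambda : R).
Variable u : 'rV[R]_(n + 1) -> R.
Implicit Types p q : 'rV[R]_(n + 1).
Hypotheses (hn : n = 1%N \/ n = 2%N) (heps : 0 < eps) (hlambda : 0 < lambda).
Hypothesis u_per : forall t : R, 0 <= t <= 1 -> torus_periodic (slice u t).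
Hypothesis u_smooth : smooth_on (@closed_slab R n) u.
Hypothesis u_eq : forall p, 0 < time p < 1 ->
  \det (hessian u p + space_id R n) = eps.
Hypothesis u_psh : forall p, 0 < time p < 1 ->
  psdmx (hessian u p + space_id R n).
Hypothesis u_bdry : forall p, time p = 0 \/ time p = 1 ->
  mxge (hessian (slice u (time p)) (place p) + 1%:M) (lambda *: 1%:M).

Let A p : 'M[R]_n := hessian (slice u (time p)) (place p) + 1%:M.

Lemma slab_cases p : closed_slab p -> 0 < time p < 1 \/ (time p = 0 \/ time p = 1).
Proof.
move=> /closed_slabP; rewrite le_eqVlt (le_eqVlt _ 1) => /andP[].
by move=> /orP[/eqP <-|->]; [right; left|move=> /orP[/eqP ->|->]; [right; right|left]].
Qed.

(** Since the determinant [eps] is nonzero, the full matrix is definite, and so is its spatial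
    block. *)
Lemma space_form_interior_gt0 p a : 0 < time p < 1 -> a != 0 -> 0 < bil (A p) a a.
Proof.
move=> p01 a0; rewrite -[bil _ _ _]/(space_form u a a p) space_formE.
apply: psd_bil_gt0; [exact: u_psh|by rewrite u_eq// gt_eqF|].
by apply: contra a0; rewrite -row_mx0 => /eqP/eq_row_mx[-> _].
Qed.

Lemma space_form_interior_tr p : 0 < time p < 1 -> (A p)^T = A p.
Proof.
move=> p01; have [Hs _] := u_psh p01.
have -> : A p = ulsubmx (hessian u p + space_id R n).
  rewrite /A hessian_slice spacetimeK /space_id -[hessian u p]submxK.
  by rewrite add_block_mx !block_mxKul.
by rewrite trmx_ulsub Hs.
Qed.

Lemma space_form_bdry p a : time p = 0 \/ time p = 1 ->
  lambda * bil 1%:M a a <= bil (A p) a a.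
Proof.
move=> /u_bdry[_ /(_ a)]; rewrite -[X in 0 <= X]/(bil _ a a).
by rewrite bil_add bil_opp bil_scale subr_ge0.
Qed.

Lemma space_form_tr p : closed_slab p -> (A p)^T = A p.
Proof.
move=> /slab_cases[/space_form_interior_tr//|/u_bdry[+ _]].
by rewrite linearB /= linearZ /= trmx1 => /addIr.
Qed.

Lemma space_form_gt0 p a : closed_slab p -> a != 0 -> 0 < bil (A p) a a.
Proof.
move=> /slab_cases[p01|pb] a0; first exact: space_form_interior_gt0.
by rewrite (lt_le_trans _ (space_form_bdry a pb))// mulr_gt0// bil1_gt0.
Qed.

Lemma space_form_lower_bound p g : 0 < time p < 1 ->
  lambda * bil 1%:M g g <= bil (A p) g g.
Proof.
move=> p01; have [->|g0] := eqVneq g 0; first by rewrite !bil0l mulr0.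
rewrite leNgt; apply/negP => pg.
have [f [kappa [gf frame detV]]] := frame_exists hn g0.
pose N q := space_form u f f q + kappa.
pose D q := space_form u g g q * N q - space_form u g f q ^+ 2.
have N0 q : closed_slab q -> 0 < N q.
  by move=> sq; apply: (frame_gt0 frame) => a; exact: space_form_gt0.
have D0 q : closed_slab q -> 0 < D q.
  move=> sq; apply: (frame_det_gt0 (space_form_tr sq) g0 gf frame) => a.
  exact: space_form_gt0.
have sp : closed_slab p.
  by apply/closed_slabP; case/andP: p01 => /ltW -> /ltW ->.
pose c := lambda * bil 1%:M g g.
have c0 : 0 < c by rewrite mulr_gt0// bil1_gt0.
have bdry q : time q = 0 \/ time q = 1 -> N q / D q <= c^-1.
  move=> qb; have sq : closed_slab q.
    by apply/closed_slabP; case: qb => ->; rewrite lexx ler01.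
  rewrite ler_pdivrMr ?D0// -(ler_pM2l c0) mulrA divff ?mul1r ?gt_eqF//.
  apply: (frame_lower_bound (space_form_tr sq) gf frame _ hlambda).
    by move=> a; exact: space_form_gt0.
  by move=> a; exact: space_form_bdry.
(* Dropping the square gives D <= A(g,g) N at [p], and A(g,g) < [c] by assumption; the quotient thus
   exceeds its boundary bound. *)
have gap : c^-1 < N p / D p.
  rewrite ltr_pdivlMr ?D0// -(ltr_pM2l c0) mulrA divff ?mul1r ?gt_eqF//.
  apply: (@le_lt_trans _ _ (space_form u g g p * N p)).
    by rewrite lerBlDr lerDl sqr_ge0.
  by rewrite ltr_pM2r ?N0.
(* Half the gap: on the boundary [delta * time q ^+ 2] is at most [delta], which cannot lift [w] to
   [N p / D p]. The maximum of [w] is therefore interior. *)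
pose delta := (N p / D p - c^-1) / 2.
have delta0 : 0 < delta by rewrite divr_gt0// subr_gt0.
pose w q := N q / D q + delta * time q ^+ 2.
have [||p0 sp0 p0max] := @slab_max R n w.
- move=> q sq.
  have cN : N @ within (@closed_slab R n) (nbhs q) --> N q.
    by apply: cvgD; [exact: space_form_continuous|exact: cvg_cst].
  have cgf := @space_form_continuous R n u g f q u_smooth sq.
  apply: cvgD.
    apply: cvgM => //; apply: cvgV; first by rewrite gt_eqF ?D0.
    apply: cvgB; first by apply: cvgM => //; exact: space_form_continuous.
    exact: cvgM.
  apply: cvgM; first exact: cvg_cst.
  have ct : @time R n @ within (@closed_slab R n) (nbhs q) --> time q.
    by apply: cvg_within_filter; exact: time_continuous.
  exact: cvgM.
- move=> q z /closed_slabP q01; have per a b := space_form_periodic a b z (u_per q01).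
  by rewrite /w /D /N !per /time mxE row_mxEr mxE addr0.
have pw : N p / D p <= w p by rewrite lerDl mulr_ge0 ?sqr_ge0// ltW.
have := p0max p sp; rewrite leNgt => /negP; apply.
have [p0in|p0b] := slab_cases sp0; last first.
  apply: lt_le_trans pw; apply: (@le_lt_trans _ _ (c^-1 + delta)).
    apply: lerD; first exact: bdry.
    by case: p0b => ->; rewrite ?expr0n ?expr1n ?mulr0 ?mulr1 // ltW.
  by rewrite /delta; lra.
exfalso.
have [U [F [Uo Up sF Fu]]] := u_smooth sp0.
(* On this open set [F] and [u] coincide, hence so do their full Hessians, and the equation passes
   to the smooth [F]. *)
pose V := U `&` (@time R n @^-1` `]0, 1[%classic).
have Vo : open V.
  apply: openI => //; apply: open_comp; last exact: interval_open.
  by move=> q _; exact: time_continuous.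
have VU q : V q -> U q by case.
have Vt q : V q -> 0 < time q < 1 by case=> _ /=; rewrite in_itv.
have Vs q : V q -> closed_slab q.
  by move=> /Vt/andP[/ltW a /ltW b]; apply/closed_slabP; rewrite a b.
have HE q : V q -> hessian F q = hessian u q.
  move=> Vq; apply: hessian_near.
  have : \forall y \near q, V y by exact: open_nbhs_nbhs.
  by apply: filterS => y Vy; apply: Fu; split; [exact: Vs|exact: VU].
have sFE a b q : V q ->
    bil (hessian F q + space_id R n) (row_mx a 0) (row_mx b 0) = space_form u a b q.
  by move=> Vq; rewrite HE// space_formE.
have Vp0 : V p0 by split => //=; rewrite in_itv.
apply: (interior_max_contradiction Vo (F := F) (p := p0) (eps := eps)
  (delta := delta) (kappa := kappa) (g := g) (f := f)) => //.
- by move=> s q /VU; exact: sF.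
- by rewrite HE//; exact: u_psh.
- by move=> q Vq; rewrite HE// u_eq// Vt.
- by case: frame => -[? ?]; [left|right].
- by rewrite sFE// N0.
- by rewrite !sFE// D0.
move=> q Vq.
suff H : N q <=
    (N p0 / D p0 - delta * (time q ^+ 2 - time p0 ^+ 2)) * D q.
  (* Generalizing keeps unification from comparing the two hessians by unfolding. *)
  have Eq a b := sFE a b q Vq; have Ep a b := sFE a b p0 Vp0.
  generalize dependent (hessian F q); generalize dependent (hessian F p0).
  by move=> Hp Ep Hq Eq; rewrite !Eq !Ep; exact: H.
rewrite -ler_pdivrMr; last exact/D0/Vs.
have wq : N q / D q + delta * time q ^+ 2 <= N p0 / D p0 + delta * time p0 ^+ 2.
  exact: p0max q (Vs q Vq).
by rewrite mulrBr opprB addrA lerBrDr.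
Qed.

End MainEstimate.

Theorem theorem1 (R : realType) (n : nat) (eps lambda : R)
    (u0 u1 : 'rV[R]_n -> R) (u : 'rV[R]_(n + 1) -> R)
    (hn : n = 1%N \/ n = 2%N)
    (heps : 0 < eps) (hlambda : 0 < lambda)
    (u0_per : torus_periodic u0) (u0_smooth : smooth_on setT u0)
    (u1_per : torus_periodic u1) (u1_smooth : smooth_on setT u1)
    (u0_conv : forall x, mxge (hessian u0 x + 1%:M) (lambda *: 1%:M))
    (u1_conv : forall x, mxge (hessian u1 x + 1%:M) (lambda *: 1%:M))
    (u_per : forall t : R, 0 <= t <= 1 -> torus_periodic (slice u t))
    (u_smooth : smooth_on (@closed_slab R n) u)
    (u_eq : forall (x : 'rV[R]_n) (t : R), 0 < t < 1 ->
      \det (hessian u (spacetime x t) + space_id R n) = eps)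
    (u_psh : forall (x : 'rV[R]_n) (t : R), 0 < t < 1 ->
      mxge (hessian u (spacetime x t) + space_id R n) 0)
    (u_init : forall x, slice u 0 x = u0 x)
    (u_final : forall x, slice u 1 x = u1 x) :
  forall (x : 'rV[R]_n) (t : R), 0 < t < 1 ->
    mxge (hessian (slice u t) x + 1%:M) (lambda *: 1%:M).
Proof.
have det_eq p : 0 < time p < 1 -> \det (hessian u p + space_id R n) = eps.
  by move=> /(u_eq (place p)); rewrite spacetimeK.
have psd p : 0 < time p < 1 -> psdmx (hessian u p + space_id R n).
  by move=> /(u_psh (place p)); rewrite spacetimeK /mxge subr0.
have bdry p : time p = 0 \/ time p = 1 ->
    mxge (hessian (slice u (time p)) (place p) + 1%:M) (lambda *: 1%:M).
  by case=> ->; [rewrite (funext u_init)|rewrite (funext u_final)].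
move=> x t t01.
have p01 : 0 < time (spacetime x t) < 1 by rewrite time_spacetime.
have tr := space_form_interior_tr psd p01.
have lower g := space_form_lower_bound hn heps hlambda u_per u_smooth
  det_eq psd bdry g p01.
rewrite time_spacetime place_spacetime in tr lower.
split=> [|v]; first by rewrite linearB /= tr linearZ /= trmx1.
by rewrite -[X in 0 <= X]/(bil _ v v) bil_add bil_opp bil_scale subr_ge0.
Qed.
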